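(* Let $A$ be a finite-dimensional Leibniz algebra over an algebraically closed field and let $M$ be a finite-dimensional $A$-module. There is a basis of $M$ with respect to which the matrices representing all the linear transformations $T_x$ and $S_x$ ($x \in A$) of $M$ are upper triangular if and only if $A^2$ is nil on $M$.
   Context: A Leibniz algebra over a field $F$ is an $F$-vector space $A$ with a bilinear product satisfying the (left) Leibniz identity $x(yz) = (xy)z + y(xz)$ for all $x,y,z \in A$. An $A$-module $M$ is an $F$-vector space with bilinear left and right actions $A \times M \to M$, $(x,m)\mapsto xm$, and $M \times A \to M$, $(m,x)\mapsto mx$, such that for all $x,y\in A$, $m \in M$: $x(ym) = (xy)m + y(xm)$, $x(my) = (xm)y + m(xy)$, and $m(xy) = (mx)y + x(my)$. For $x \in A$, $T_x: M \to M$ denotes left multiplication $m \mapsto xm$ and $S_x : M \to M$ denotes right multiplication $m \mapsto mx$. $A^2$ denotes the span of all products $xy$ with $x,y\in A$. A subalgebra $C$ of $A$ is said to be nil on $M$ if $T_x$ is a nilpotent linear transformation of $M$ for every $x \in C$ (it is known that then $S_x$ is nilpotent as well for every $x\in C$, and that $C$ acts nilpotently on $M$, i.e. there is $n$ such that every product of $n$ operators from $\{T_x, S_x : x \in C\}$ is zero on $M$). *)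

(* Defs.v *)
From HB Require Import structures.
From mathcomp Require Import all_boot all_order all_algebra.

Set Implicit Arguments.
Unset Strict Implicit.
Unset Printing Implicit Defensive.

Import GRing.Theory.
Local Open Scope ring_scope.

Section Leibniz.

Variables (F : fieldType) (A M : lmodType F).
Variable mul : {bilinear A -> A -> A}.
Variables (lact : {bilinear A -> M -> M}) (ract : {bilinear M -> A -> M}).

(* Left Leibniz identity: left multiplications are derivations. *)
Definition leibniz_algebra : Prop :=
  forall x y z : A, mul x (mul y z) = mul (mul x y) z + mul y (mul x z).

Record leibniz_module : Prop := LeibnizModule {
  leibniz_module_LL : forall (x y : A) (m : M),
    lact x (lact y m) = lact (mul x y) m + lact y (lact x m);
  leibniz_module_LR : forall (x y : A) (m : M),
    lact x (ract m y) = ract (lact x m) y + ract m (mul x y);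
  leibniz_module_RR : forall (x y : A) (m : M),
    ract m (mul x y) = ract (ract m x) y + lact x (ract m y) }.

Definition leibniz_T (x : A) : M -> M := fun m => lact x m.
Definition leibniz_S (x : A) : M -> M := fun m => ract m x.

(* Membership in A^2, the linear span (not just the set) of all products. *)
Definition leibniz_square (z : A) : Prop :=
  exists s : seq (F * (A * A)), z = \sum_(p <- s) p.1 *: mul p.2.1 p.2.2.

Definition nilpotent_map (f : M -> M) : Prop :=
  exists n : nat, forall m : M, iter n f m = 0.

(* Only the operators T_x are required to be nilpotent, and the exponent may
   depend on x. *)
Definition nil_on (C : A -> Prop) : Prop :=
  forall x : A, C x -> nilpotent_map (leibniz_T x).

End Leibniz.

(* Column convention: column j holds the coordinates of f b_j.  The library's
   mxof is the transpose of this, as it acts on row vectors. *)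
Definition basis_matrix (F : fieldType) (V : vectType F) (n : nat)
    (b : n.-tuple V) (f : V -> V) : 'M[F]_n :=
  \matrix_(i < n, j < n) coord b i (f b`_j).

(* is_trig_mx means lower triangular. *)
Definition upper_triangular (F : fieldType) (n : nat) (X : 'M[F]_n) : bool :=
  is_trig_mx X^T.

(* Main.v *)
Require Import Defs.
From HB Require Import structures.
From mathcomp Require Import all_boot all_order all_algebra.

Set Implicit Arguments.
Unset Strict Implicit.
Unset Printing Implicit Defensive.

Import GRing.Theory.
Local Open Scope ring_scope.

(** If a basis of [M] makes every [T_x] upper triangular, then
[T_(xy) = [T_x, T_y]] is strictly upper triangular, because the diagonal
entries of [T_x T_y] and [T_y T_x] agree; so is [T_z] for every [z] in [A^2],
and it is nilpotent ([triangular_square_nil]).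

For the converse, a triangular basis is the same as a complete flag of
submodules, and such a flag is grown one line at a time
([triangular_basis]): given a proper submodule [W], a vector [w] outside [W]
is needed with [W + <[w]>] a submodule ([extend_submodule]).  This is the
statement that the nonzero module [M / W] has a one-dimensional submodule, but
quotients are never formed: throughout, relations hold modulo [W] and vectors
that are nonzero modulo [W] are vectors outside [W].

Three ingredients give [w].
- The operators [T_z], [z] in [A^2], form a Lie algebra of nilpotent operators,
  so Engel's theorem ([engel]) provides vectors outside [W] that all of them
  send into [W].
- On these vectors the operators [T_x] commute modulo [W]; over an
  algebraically closed field they have a common eigenvector modulo [W]
  ([common_eigenvector_mod], [left_eigenvector]).  This deals with the left
  action.
- Adding the module identities for [x(my)] and [m(xy)] gives
  [(xm + mx)y = 0].  Let [N] be the set of [m] with [mA] inside [W]; it contains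
  every [xm + mx] and is stable under the left action.  If [N] is not inside
  [W], an eigenvector taken in [N] works, as the right action sends it into
  [W]; if [N] is inside [W], then [mx = - xm] modulo [W], and any
  eigenvector for the left action is one for the right action too.

Engel's theorem is proved by growing a subalgebra [H] of a Lie algebra [K] one
dimension at a time, as long as [H] has the conclusion of the theorem in every
representation where it acts by nilpotent maps.  Applying this to the adjoint
action of [H] on [K], modulo [H], yields the next line to add. *)

(** * Leaving the complement of a subspace *)

(** How quotient-free arguments produce vectors: an orbit that starts outside
[W] and ends inside [W] has a last point outside [W], where one more step
lands in [W]; any property preserved along the orbit holds there. *)
Lemma foldl_exit (F : fieldType) (V : vectType F) (I : Type) (g : V -> I -> V)
    (P : V -> Prop) (W : {vspace V}) (s : seq I) (v : V) :
  (forall w i, P w -> P (g w i)) -> P v -> v \notin W -> foldl g v s \in W ->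
  exists w i, [/\ P w, w \notin W & g w i \in W].
Proof.
move=> Pg; elim: s v => [|i s IHs] v /= Pv vW; first by rewrite (negPf vW).
by have [gvW _|gvW] := boolP (g v i \in W); [exists v, i | apply/IHs/gvW/Pg].
Qed.

Lemma nilpotent_exit (F : fieldType) (V : vectType F) (f : V -> V)
    (P : V -> Prop) (W : {vspace V}) (v : V) :
  nilpotent_map f -> (forall w, P w -> P (f w)) -> P v -> v \notin W ->
  exists w, [/\ P w, w \notin W & f w \in W].
Proof.
move=> [n fn0] Pf Pv vW.
have [||w [_ ?]] :=
  @foldl_exit _ _ _ (fun w _ => f w) P W (nseq n tt) v _ Pv vW.
- by move=> w _; apply: Pf.
- suff /(_ n v) -> :
      forall k u, foldl (fun w _ => f w) u (nseq k tt) = iter k f u.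
    by rewrite fn0 mem0v.
  by elim=> //= k IHk u; rewrite IHk -iterSr.
- by exists w.
Qed.

Lemma span_stable (F : fieldType) (U V : vectType F) (f : {linear U -> V})
    (X : seq U) (W : {vspace V}) (u : U) :
  {in X, forall v, f v \in W} -> u \in <<X>>%VS -> f u \in W.
Proof.
move=> fX uX; rewrite -[f u](lfunE f).
apply: subvP (memv_img (linfun f) uX); rewrite limg_span.
apply/span_subvP => _ /mapP[v vX ->].
by rewrite lfunE fX.
Qed.

Lemma span_vbasis (F : fieldType) (V : vectType F) (v : V) :
  v \in <<vbasis {:V}>>%VS.
Proof. by rewrite (span_basis (vbasisP _)) memvf. Qed.

(** * Engel's theorem *)

Section Engel.

Variables (F : fieldType) (L : vectType F) (br : {bilinear L -> L -> L}).
Hypothesis br_alt : forall x, br x x = 0.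
Hypothesis br_jacobi :
  forall x y z, br (br x y) z = br x (br y z) - br y (br x z).

Lemma br_antisym x y : br x y = - br y x.
Proof.
apply/eqP; rewrite -addr_eq0; apply/eqP.
have := br_alt (x + y).
by rewrite linearDl !linearDr /= !br_alt add0r addr0.
Qed.

(** The conclusion of Engel's theorem for [H], in all representations at once
and relative to [W]: with [P] a stable set in place of a submodule, it says that
[H] kills some nonzero vector of [P / W].  Quantifying over the
representation allows the same [H] to act on a module and on the Lie algebra
itself. *)
Definition engel_property (H : {vspace L}) : Prop :=
  forall (V : vectType F) (rho : {bilinear L -> V -> V}),
    (forall x y v, rho (br x y) v = rho x (rho y v) - rho y (rho x v)) ->
    {in H, forall x, nilpotent_map (rho x)} ->
  forall (W : {vspace V}) (P : V -> Prop),
    (forall x w, x \in H -> w \in W -> rho x w \in W) ->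
    (forall x w, x \in H -> P w -> P (rho x w)) ->
  forall v, P v -> v \notin W ->
  exists w, [/\ P w, w \notin W & {in H, forall x, rho x w \in W}].

Lemma engel_property0 : engel_property 0%VS.
Proof.
move=> V rho _ _ W P _ _ v Pv vW; exists v; split=> // x.
by rewrite memv0 => /eqP ->; rewrite linear0l mem0v.
Qed.

(** If [x] normalizes [H], then [rho x] preserves the set of vectors that [H]
sends into [W], so the nilpotent map [rho x] can be iterated inside that set
until it enters [W]. *)
Lemma engel_property_add_line (H : {vspace L}) x :
  {in H, forall h, br h x \in H} -> engel_property H ->
  engel_property (H + <[x]>)%VS.
Proof.
move=> Hx engH V rho rhoM rho_nil W P WH PH v Pv vW.
have sH : (H <= H + <[x]>)%VS by apply: addvSl.
have xH : x \in (H + <[x]>)%VS by apply: subvP (addvSr _ _) _ (memv_line x).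
have [|||w1 [Pw1 w1W Hw1]] := engH V rho rhoM _ W P _ _ v Pv vW.
- by move=> h /(subvP sH); apply: rho_nil.
- by move=> h w /(subvP sH); apply: WH.
- by move=> h w /(subvP sH); apply: PH.
have [|w [[Pw Hw] wW xw]] := @nilpotent_exit _ _ (rho x)
    (fun w => P w /\ {in H, forall h, rho h w \in W}) W w1 (rho_nil x xH) _
    (conj Pw1 Hw1) w1W.
- move=> w [Pw Hw]; split=> [|h hH]; first exact: PH.
  have -> : rho h (rho x w) = rho (br h x) w + rho x (rho h w).
    by rewrite rhoM subrK.
  by apply: memvD; [apply/Hw/Hx | apply: WH (Hw h hH)].
exists w; split=> // _ /memv_addP[h hH [_ /vlineP[c ->] ->]].
by rewrite linearDl linearZl_LR; apply: memvD; [apply: Hw | apply: memvZ].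
Qed.

(** The subalgebra [H] grows up to [K]: while [H] is proper, its own Engel
property, for the adjoint action on [K] modulo [H], gives [x] in [K] outside [H]
with [[H, x]] inside [H], and then [H + <[x]>] is again a subalgebra. *)
Theorem engel (K : {vspace L}) :
  {in K &, forall x y, br x y \in K} ->
  {in K, forall x, nilpotent_map (br x)} -> engel_property K.
Proof.
move=> Kbr ad_nil.
suff grow d : (d <= \dim K)%N -> exists H : {vspace L},
    [/\ (H <= K)%VS, \dim H = d, {in H &, forall x y, br x y \in H}
      & engel_property H].
  have [H [sHK dH _ engH]] := grow _ (leqnn _).
  by have /eqP <- : H == K by rewrite eqEdim sHK dH /=.
elim: d => [_|d IHd ltdK].
  exists 0%VS; split; rewrite ?sub0v ?dimv0 //; last exact: engel_property0.
  by move=> x y; rewrite !memv0 => /eqP -> _; rewrite linear0l.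
have [H [sHK dH Hbr engH]] := IHd (ltnW ltdK).
have /subvPn[y yK yH] : ~~ (K <= H)%VS.
  by apply: contraL ltdK => /dimvS; rewrite dH -leqNgt.
have [|||x [xK xH Hx]] :=
    engH L br br_jacobi _ H (fun z => z \in K) _ _ y yK yH.
- by move=> h /(subvP sHK); apply: ad_nil.
- by move=> h z; apply: Hbr.
- by move=> h z /(subvP sHK); apply: Kbr.
exists (H + <[x]>)%VS; split.
- by rewrite subv_add sHK -memvE.
- rewrite dimv_disjoint_sum ?dH ?dim_vline.
    by rewrite (contraNneq _ xH) ?addn1 // => ->; rewrite mem0v.
  apply/eqP; rewrite -subv0; apply/subvP=> z /memv_capP[zH /vlineP[c zE]].
  rewrite memv0; have [c0|c0] := eqVneq c 0; first by rewrite zE c0 scale0r.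
  by case/negP: xH; rewrite -[x]scale1r -(mulVf c0) -scalerA -zE memvZ.
- move=> _ _ /memv_addP[h hH [_ /vlineP[c ->] ->]]
          /memv_addP[k kH [_ /vlineP[e ->] ->]].
  apply: subvP (addvSl _ _) _ _.
  rewrite linearDl !linearDr /= !linearZl_LR !linearZr_LR /= br_alt.
  rewrite !scaler0 addr0.
  rewrite [br x k]br_antisym.
  by do !apply: memvD; do ?apply: memvZ; rewrite ?memvN; auto.
- exact: engel_property_add_line.
Qed.

End Engel.

(** * The Lie algebra of endomorphisms *)

Section EndomorphismLieAlgebra.

Variables (F : fieldType) (V : vectType F).

(** The natural representation of ['End(V)] on [V]; a named function, so that
it can carry a bilinear structure. *)
Definition lfun_app (f : 'End(V)) (v : V) : V := f v.

Lemma lfun_app_bilinear : bilinear_for *:%R *:%R lfun_app.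
Proof.
split=> [v c f g | f c u v]; rewrite /lfun_app; last exact: linearP.
by rewrite add_lfunE scale_lfunE.
Qed.

HB.instance Definition _ :=
  bilinear_isBilinear.Build F _ _ V _ _ lfun_app lfun_app_bilinear.

Definition commutator (f g : 'End(V)) : 'End(V) := ((f \o g) - (g \o f))%VF.

Lemma commutatorE f g v : commutator f g v = f (g v) - g (f v).
Proof. by rewrite add_lfunE opp_lfunE !comp_lfunE. Qed.

Lemma commutator_bilinear : bilinear_for *:%R *:%R commutator.
Proof.
split=> [h c f g | h c f g]; apply/lfunP=> v /=;
  rewrite [RHS]add_lfunE scale_lfunE !commutatorE add_lfunE scale_lfunE;
  by rewrite add_lfunE scale_lfunE linearP /= scalerBr opprD addrACA.
Qed.

HB.instance Definition _ :=
  bilinear_isBilinear.Build F _ _ _ _ _ commutator commutator_bilinear.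

Lemma commutator_alt f : commutator f f = 0.
Proof. exact: subrr. Qed.

Lemma commutator_jacobi f g h :
  commutator (commutator f g) h =
    commutator f (commutator g h) - commutator g (commutator f h).
Proof.
apply/lfunP=> v; rewrite [RHS]add_lfunE opp_lfunE !commutatorE !linearB /=.
rewrite !opprK !addrA.
by rewrite [RHS](ACl (1*5*8*4*(2*7)*(3*6)))/= !addNr !addr0.
Qed.

(** Expanding [ad(f)^N (f^i g f^j)] gives words with [N + i + j] factors [f];
when there are at least [2n] of them, [n] lie on the same side of [g].  The
exponents [i] and [j] are what makes the induction on [N] go through. *)
Lemma iter_commutator (f g h : 'End(V)) n N i j :
  (forall v, iter n f v = 0) -> (forall v, h v = iter i f (g (iter j f v))) ->
  (n + n <= N + i + j)%N -> iter N (commutator f) h = 0.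
Proof.
move=> fn0; elim: N i j h => [|N IHN] i j h hE le2n.
  have iter0 k u : (n <= k)%N -> iter k f u = 0.
    by move/subnKC <-; rewrite iterD fn0.
  apply/lfunP=> v; rewrite hE zero_lfunE; have [le_ni|lt_in] := leqP n i.
    by rewrite iter0.
  rewrite [iter j f v]iter0 ?linear0; last first.
    by rewrite -(leq_add2l n) (leq_trans le2n) // leq_add2r ltnW.
  by elim: {hE le2n lt_in} i => //= i ->; rewrite linear0.
have iterB k u v : iter k (commutator f) (u - v) =
    iter k (commutator f) u - iter k (commutator f) v.
  by elim: k => //= k ->; rewrite linearBr.
rewrite iterSr iterB (IHN i.+1 j) ?(IHN i j.+1) ?subrr //.
- by move=> v; rewrite comp_lfunE hE -iterSr.
- by rewrite addnS.
- by move=> v; rewrite comp_lfunE hE.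
- by rewrite addnS -addSn.
Qed.

Lemma commutator_nilpotent (f : 'End(V)) :
  nilpotent_map f -> nilpotent_map (commutator f).
Proof.
move=> [n fn0]; exists (n + n)%N => g.
by apply: (@iter_commutator f g g n _ 0 0); rewrite ?addn0.
Qed.

End EndomorphismLieAlgebra.

(** * Common eigenvectors modulo a subspace *)

Section CommonEigenvector.

Import VectorInternalTheory.

Variables (F : closedFieldType) (V : vectType F).

(** Cayley-Hamilton, with the characteristic polynomial split into linear
factors [X - c] that are applied one after the other, which is the form needed
to look for the factor at which an orbit enters [W]. *)
Lemma endomorphism_split (f : 'End(V)) :
  exists s : seq F, forall v, foldl (fun w c => f w - c *: w) v s = 0.
Proof.
(* Coordinates with a size [n] that can be destructed: the
   Cayley-Hamilton theorem needs the nontrivial ring of matrices of size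
   [n.+1]. *)
have [n [phi [X [phi_inj phif]]]] : exists n (phi : {linear V -> 'rV[F]_n}) X,
    injective phi /\ forall v, phi (f v) = phi v *m X.
  exists (dim V), v2r, (f2mx f); split=> [|v]; first exact: v2r_inj.
  by rewrite unlock /= r2vK.
case: n => [|n] in phi X phi_inj phif *.
  by exists [::] => v; apply: phi_inj; rewrite !thinmx0.
have [s chi] := closed_field_poly_normal (char_poly X).
rewrite (monicP (char_poly_monic X)) scale1r in chi.
have phi_foldl t u : phi (foldl (fun w c => f w - c *: w) u t) =
    phi u *m horner_mx X (\prod_(c <- t) ('X - c%:P)).
  elim: t u => [|c t IHt] u; first by rewrite big_nil rmorph1 mulmx1.
  rewrite /= IHt big_cons rmorphM rmorphB /= horner_mx_X horner_mx_C.
  by rewrite mulmxA mulmxBr mul_mx_scalar linearB linearZ /= phif.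
exists s => v; apply: phi_inj.
by rewrite phi_foldl -chi Cayley_Hamilton mulmx0 linear0.
Qed.

(** The vectors satisfying the eigenvector conditions already obtained, modulo
[W], are preserved by [f j - c] since [f j] commutes with the other maps modulo
[W]; so the linear factors of the characteristic polynomial of [f j] can be
applied within this set until [W] is entered. *)
Lemma common_eigenvector_mod (I : eqType) (f : I -> {linear V -> V})
    (W : {vspace V}) (P : V -> Prop) (r : seq I) (v : V) :
    (forall i w, w \in W -> f i w \in W) ->
    (forall i c w, P w -> P (f i w - c *: w)) ->
    (forall i j w, P w -> f i (f j w) - f j (f i w) \in W) ->
  P v -> v \notin W ->
  exists w c, [/\ P w, w \notin W & {in r, forall i, f i w - c i *: w \in W}].
Proof.
move=> Wf Pf fC Pv vW.
elim: r => [|j r [w1 [c1 [Pw1 w1W eig1]]]]; first by exists v, (fun=> 0).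
have [s ann] := endomorphism_split (linfun (f j)).
pose P1 w := P w /\ {in r, forall i, f i w - c1 i *: w \in W}.
have [||w [c [[Pw eig] wW eigj]]] := @foldl_exit _ _ _
    (fun w c => linfun (f j) w - c *: w) P1 W s w1 _ (conj Pw1 eig1) w1W _.
- move=> w c [Pw eig]; rewrite lfunE; split=> [|i ir]; first exact: Pf.
  have -> : f i (f j w - c *: w) - c1 i *: (f j w - c *: w) =
      f i (f j w) - f j (f i w) + f j (f i w - c1 i *: w)
      - c *: (f i w - c1 i *: w).
    rewrite !linearB !linearZ /= !opprK !addrA subrK !scalerA [c * _]mulrC.
    by congr (_ + _); rewrite addrAC.
  by apply: memvB; [apply: memvD; [apply: fC|apply/Wf/eig]|apply/memvZ/eig].
- by rewrite ann mem0v.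
exists w, (fun i => if i \in r then c1 i else c); split=> // i.
rewrite inE; case: ifP => [ir _|_]; first exact: eig.
by rewrite orbF => /eqP ->; rewrite lfunE in eigj.
Qed.

End CommonEigenvector.

(** * The left action of a Leibniz algebra *)

Section LeibnizSquare.

Variables (F : fieldType) (A : vectType F) (mul : {bilinear A -> A -> A}).

Definition square_space : {vspace A} :=
  <<[seq mul x y | x <- vbasis {:A}, y <- vbasis {:A}]>>.

Lemma mul_square x y : mul x y \in square_space.
Proof.
apply: (@span_stable _ _ _ (applyr mul y) _ _ x _ (span_vbasis x)) => e eA.
apply: (@span_stable _ _ _ (mul e) _ _ y _ (span_vbasis y)) => e' e'A.
exact/memv_span/allpairs_f.
Qed.

Lemma square_space_sub z : z \in square_space -> leibniz_square mul z.
Proof.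
rewrite /square_space; set X := (X in span X).
move=> /(@coord_span _ _ _ (in_tuple X)) ->.
have : forall i : 'I_(size X), exists xy : A * A, X`_i = mul xy.1 xy.2.
  move=> i; have /allpairsP[xy [_ _ ->]] := mem_nth 0 (ltn_ord i).
  by exists xy.
move=> XE; apply: (big_ind (leibniz_square mul)).
- by exists [::]; rewrite big_nil.
- by move=> _ _ [s ->] [t ->]; exists (s ++ t); rewrite big_cat.
- move=> i _; have [xy ->] := XE i.
  by exists [:: (coord (in_tuple X) i z, xy)]; rewrite big_seq1.
Qed.

End LeibnizSquare.

Section LeftRepresentation.

Variables (F : fieldType) (A M : vectType F).
Variables (mul : {bilinear A -> A -> A}) (lact : {bilinear A -> M -> M}).
Hypothesis lactM : forall x y m,
  lact x (lact y m) = lact (mul x y) m + lact y (lact x m).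

Definition left_mult (x : A) : 'End(M) := linfun (lact x).

Lemma left_mult_linear : linear left_mult.
Proof.
move=> c x y; apply/lfunP=> m.
by rewrite add_lfunE scale_lfunE !lfunE /= linearPl.
Qed.

HB.instance Definition _ :=
  GRing.isLinear.Build F A 'End(M) _ left_mult left_mult_linear.

Lemma left_mult_mul x y :
  left_mult (mul x y) = commutator (left_mult x) (left_mult y).
Proof. by apply/lfunP=> m; rewrite commutatorE !lfunE /= lactM addrK. Qed.

(** Engel's theorem for the Lie algebra of the operators [T_z], [z] in [A^2],
rather than for [A^2] itself: left multiplication by [z] on [A] need not be
nilpotent, whereas the commutator with the nilpotent [T_z] is. *)
Lemma square_common_kernel (W : {vspace M}) (P : M -> Prop) (v : M) :
    nil_on lact (leibniz_square mul) ->
    (forall x w, w \in W -> lact x w \in W) ->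
    (forall x w, P w -> P (lact x w)) -> P v -> v \notin W ->
  exists w, [/\ P w, w \notin W & forall x y, lact (mul x y) w \in W].
Proof.
move=> nilA2 WT PT Pv vW.
pose K := (linfun left_mult @: square_space mul)%VS.
have memK f : f \in K -> exists2 z, z \in square_space mul & f = left_mult z.
  by move=> /memv_imgP[z zA2 ->]; exists z; rewrite ?lfunE.
have Kmul x y : left_mult (mul x y) \in K.
  by rewrite -[left_mult _](lfunE left_mult) memv_img ?mul_square.
have Knil f : f \in K -> nilpotent_map f.
  move=> /memK[z /square_space_sub/nilA2[n Tn0] ->]; exists n => m.
  by rewrite -[RHS](Tn0 m); apply: eq_iter => u; rewrite lfunE.
have Kbr : {in K &, forall f g, commutator f g \in K}.
  by move=> _ _ /memK[x _ ->] /memK[y _ ->]; rewrite -left_mult_mul.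
have Kad : {in K, forall f, nilpotent_map (commutator f)}.
  by move=> f /Knil /commutator_nilpotent.
have [||||w [Pw wW Kw]] := engel (@commutator_alt _ M) (@commutator_jacobi _ M)
    Kbr Kad (rho := @lfun_app _ M) _ _ (W := W) (P := P) _ _ Pv vW.
- exact: commutatorE.
- exact: Knil.
- by move=> _ m /memK[x _ ->] mW; rewrite /= /lfun_app lfunE WT.
- by move=> _ m /memK[x _ ->] Pm; rewrite /= /lfun_app lfunE; apply: PT.
exists w; split=> // x y; have := Kw _ (Kmul x y).
by rewrite /= /lfun_app lfunE.
Qed.

End LeftRepresentation.

(** The vectors of [P] sent into [W] by [A^2] are preserved by every [T_x], as
[A^2] is a left ideal, and on them [[T_x, T_y] = T_(xy)] vanishes modulo
[W]. *)
Lemma left_eigenvector (F : closedFieldType) (A M : vectType F)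
    (mul : {bilinear A -> A -> A}) (lact : {bilinear A -> M -> M})
    (W P : {vspace M}) :
    (forall x y m, lact x (lact y m) = lact (mul x y) m + lact y (lact x m)) ->
    nil_on lact (leibniz_square mul) ->
    (forall x w, w \in W -> lact x w \in W) ->
    (forall x w, w \in P -> lact x w \in P) ->
    ~~ (P <= W)%VS ->
  exists w, [/\ w \in P, w \notin W
    & forall x, lact x w \in (W + <[w]>)%VS].
Proof.
move=> lactM nilA2 WT PT /subvPn[v Pv vW].
have [w1 [Pw1 w1W ker1]] :=
  square_common_kernel (P := fun w => w \in P) lactM nilA2 WT PT Pv vW.
pose P1 w := w \in P /\ forall x y, lact (mul x y) w \in W.
have [||w [c [[Pw _] wW eig]]] := @common_eigenvector_mod _ _ A
    (fun x => lact x) W P1 (vbasis {:A}) w1 WT _ _ (conj Pw1 ker1) w1W.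
- move=> x c w [Pw kerw]; split=> [|y z].
    by rewrite memvB ?memvZ ?PT.
  rewrite linearB linearZ /= memvB ?memvZ //.
  have -> : lact (mul y z) (lact x w) = lact x (lact (mul y z) w)
      - lact (mul x (mul y z)) w
    by rewrite [lact x (lact (mul y z) w)]lactM addrAC subrr add0r.
  by apply: memvB; [apply: WT|]; apply: kerw.
- by move=> x y w [_ kerw]; rewrite /= lactM addrK.
exists w; split=> // x.
apply: (@span_stable _ _ _ (applyr lact w) _ _ x _ (span_vbasis x)) => e eA /=.
by rewrite -[lact e w](subrK (c e *: w)) memv_add ?eig ?memvZ ?memv_line.
Qed.

(** * One-dimensional extensions of submodules *)

(** If the right action sends some vector outside [W] into [W], the left
eigenvector is sought among such vectors; otherwise the right action is the
negative of the left one modulo [W], and any left eigenvector will do. *)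
Lemma extend_submodule (F : closedFieldType) (A M : vectType F)
    (mul : {bilinear A -> A -> A})
    (lact : {bilinear A -> M -> M}) (ract : {bilinear M -> A -> M})
    (W : {vspace M}) :
    leibniz_module mul lact ract -> nil_on lact (leibniz_square mul) ->
    (forall x w, w \in W -> lact x w \in W) ->
    (forall x w, w \in W -> ract w x \in W) ->
    ~~ ({:M} <= W)%VS ->
  exists w, [/\ w \notin W, forall x, lact x w \in (W + <[w]>)%VS
    & forall x, ract w x \in (W + <[w]>)%VS].
Proof.
move=> [LL LR RR] nilA2 WT WS properW.
have sub_line w u : u \in W -> u \in (W + <[w]>)%VS by apply/subvP/addvSl.
pose N := (\bigcap_(i < \dim {:A})
  (linfun (applyr ract (vbasis {:A})`_i) @^-1: W))%VS.
have memN m : (m \in N) <-> (forall x, ract m x \in W).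
  split=> [mN x | mS].
    apply: (@span_stable _ _ _ (ract m) _ _ x _ (span_vbasis x)).
    move=> e /(nthP 0)[i]; rewrite size_tuple => lti <-.
    move: mN; rewrite memvE => /subv_bigcapP/(_ (Ordinal lti) isT).
    by rewrite -memvE -memv_preim lfunE.
  rewrite memvE; apply/subv_bigcapP=> i _.
  by rewrite -memvE -memv_preim lfunE /= mS.
have [sNW | nNW] := boolP (N <= W)%VS; last first.
  have [|w [/memN wS wW wT]] := left_eigenvector LL nilA2 WT _ nNW.
    move=> x w /memN wS; apply/memN=> y.
    have -> : ract (lact x w) y = lact x (ract w y) - ract w (mul x y).
      by rewrite LR addrK.
    by apply: memvB; [apply: WT|]; apply: wS.
  by exists w; split=> // x; apply: sub_line.
have [|w [_ wW wT]] := left_eigenvector LL nilA2 WT _ properW.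
  by move=> x w _; apply: memvf.
exists w; split=> // x.
(* Adding the module identities for [x(wy)] and [w(xy)] gives
   [(xw + wx)y = 0]. *)
have /(subvP sNW)/(sub_line w) : lact x w + ract w x \in N.
  apply/memN=> y; rewrite linearDl /=.
  have /eqP := RR x y w.
  by rewrite LR addrA -subr_eq subrr eq_sym addrC => /eqP ->; rewrite mem0v.
by rewrite memvE => /memvB/(_ (wT x)); rewrite addrAC subrr add0r.
Qed.

(** * Triangular matrices and flags *)

Section TriangularMatrices.

Variables (F : fieldType) (V : vectType F).

Lemma coord_span_take n (b : n.-tuple V) k (i : 'I_n) u :
  free b -> u \in <<take k b>>%VS -> (k <= i)%N -> coord b i u = 0.
Proof.
move=> bF /(@coord_span _ _ _ (in_tuple (take k b))) -> leki.
rewrite linear_sum big1 // => l _; rewrite linearZ /=.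
have ltlk : (l < k)%N.
  by rewrite (leq_trans (ltn_ord l)) // size_take; case: ltnP.
have ltln : (l < n)%N by rewrite (ltn_trans ltlk) // (leq_ltn_trans leki).
have /= bil := coord_free (Ordinal ltln) i bF.
by rewrite nth_take // bil -val_eqE /= ltn_eqF ?mulr0 // (leq_trans ltlk).
Qed.

Lemma upper_triangularP n (b : n.-tuple V) (f : V -> V) :
  basis_of {:V} b ->
  reflect (forall j : 'I_n, f b`_j \in <<take j.+1 b>>%VS)
          (upper_triangular (basis_matrix b f)).
Proof.
move=> bB; apply: (iffP is_trig_mxP) => [tri j | tri j i ltji].
  rewrite (coord_basis bB (memvf (f b`_j))); apply: memv_suml => i _.
  have [le_ij | lt_ji] := leqP i j.
    rewrite memvZ // memv_span // -(nth_take 0 (ltnSE _ : i < j.+1)%N) //.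
    by rewrite mem_nth // size_take size_tuple; case: ifP.
  by have := tri j i lt_ji; rewrite !mxE => ->; rewrite scale0r mem0v.
by rewrite !mxE (coord_span_take (basis_free bB) (tri j)).
Qed.

(** Each new vector goes last, so that the spans of the earlier prefixes, and
with them the conditions already met, do not change. *)
Lemma triangular_basis (I : Type) (f : I -> {linear V -> V}) :
  (forall W : {vspace V}, (forall i w, w \in W -> f i w \in W) ->
     ~~ ({:V} <= W)%VS ->
     exists2 w, w \notin W & forall i, f i w \in (W + <[w]>)%VS) ->
  exists b : (\dim {:V}).-tuple V, basis_of {:V} b /\
    forall i, upper_triangular (basis_matrix b (f i)).
Proof.
move=> extend.
suff grow n : (n <= \dim {:V})%N -> exists b : n.-tuple V,
    [/\ free b, forall i w, w \in <<b>>%VS -> f i w \in <<b>>%VS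
      & forall i j, (j < n)%N -> f i b`_j \in <<take j.+1 b>>%VS].
  have [b [bF _ tri]] := grow _ (leqnn _); exists b.
  have bB : basis_of {:V} b by rewrite basisEfree bF subvf size_tuple /=.
  by split=> // i; apply/(upper_triangularP _ bB) => j; apply: tri.
elim: n => [_|n IHn ltn].
  exists [tuple]; split=> [||i j //]; first exact: nil_free.
  by move=> i w; rewrite span_nil !memv0 => /eqP ->; rewrite linear0.
have [b [bF bf tri]] := IHn (ltnW ltn).
have [|w wb wf] := extend _ bf.
  by apply: contraL ltn => /dimvS; rewrite (eqP bF) size_tuple -leqNgt.
have spanE : <<rcons b w>>%VS = (<<b>> + <[w]>)%VS.
  by rewrite -cats1 span_cat span_seq1.
exists [tuple of rcons b w]; split=> [|i u|i j].
- by rewrite /= (perm_free (Y := w :: b)) ?perm_rcons // free_cons wb bF.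
- rewrite /= spanE => /memv_addP[v vb [_ /vlineP[c ->] ->]].
  by rewrite linearD linearZ /= memvD ?memvZ // (subvP (addvSl _ _)) ?bf.
- rewrite /= ltnS leq_eqVlt nth_rcons size_tuple => /predU1P[->|ltj].
    by rewrite ltnn eqxx take_oversize ?size_rcons ?size_tuple // spanE wf.
  by rewrite ltj -cats1 takel_cat ?size_tuple // tri.
Qed.

End TriangularMatrices.

(** With [V k] the span of the first [k] basis vectors, each [T_x] acts on the
line [V k.+1 / V k] by a scalar, so the commutator [T_(xy)] acts on it by
zero. *)
Lemma triangular_square_nil (F : fieldType) (A M : vectType F) n
    (mul : {bilinear A -> A -> A}) (lact : {bilinear A -> M -> M})
    (b : n.-tuple M) :
    (forall x y m, lact x (lact y m) = lact (mul x y) m + lact y (lact x m)) ->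
    basis_of {:M} b ->
    (forall x, upper_triangular (basis_matrix b (lact x))) ->
  nil_on lact (leibniz_square mul).
Proof.
move=> lactM bB tri _ [s ->]; pose V k := <<take k b>>%VS.
have VS k : (k < n)%N -> V k.+1 = (V k + <[b`_k]>)%VS.
  move=> ltk; rewrite /V (take_nth 0) ?size_tuple //.
  by rewrite -cats1 span_cat span_seq1.
have nthV j k : (j < n)%N -> (j < k)%N -> b`_j \in V k.
  move=> ltjn ltjk; rewrite memv_span // -(nth_take 0 ltjk) mem_nth //.
  by rewrite size_take size_tuple; case: ifP.
have V_ind k (f : {linear M -> M}) (U : {vspace M}) u :
    (forall j, (j < n)%N -> (j < k)%N -> f b`_j \in U) ->
    u \in V k -> f u \in U.
  move=> fb uV; apply: span_stable uV => e /(nthP 0)[j].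
  rewrite size_take_min size_tuple leq_min => /andP[ltjk ltjn] <-.
  by rewrite nth_take // fb.
have subV j k : (j <= k)%N -> (V j <= V k)%VS.
  move=> lejk; apply/span_subvP=> e /(nthP 0)[i].
  rewrite size_take_min size_tuple leq_min => /andP[ltij ltin] <-.
  by rewrite nth_take // nthV // (leq_trans ltij).
have Tb x j : (j < n)%N -> lact x b`_j \in V j.+1.
  by move=> ltj; apply: (elimT (upper_triangularP _ bB) (tri x) (Ordinal ltj)).
have TV x k u : u \in V k -> lact x u \in V k.
  apply: V_ind => j ltjn ltjk; exact: subvP (subV _ _ ltjk) _ (Tb x j ltjn).
have Tmul x y j : (j < n)%N -> lact (mul x y) b`_j \in V j.
  move=> ltj.
  have := Tb x j ltj; rewrite VS // => /memv_addP[u uV [_ /vlineP[c ->] xE]].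
  have := Tb y j ltj; rewrite VS // => /memv_addP[v vV [_ /vlineP[d ->] yE]].
  have -> : lact (mul x y) b`_j =
      lact x (lact y b`_j) - lact y (lact x b`_j) by rewrite lactM addrK.
  rewrite xE yE !linearDr !linearZr_LR /= xE yE !scalerDr !scalerA [d * c]mulrC.
  rewrite !addrA opprD addrACA subrr addr0.
  by apply: memvB; apply: memvD; rewrite ?memvZ ?TV.
set z := \sum_(p <- s) _; exists n => m.
suff iterV k : (k <= n)%N -> iter k (leibniz_T lact z) m \in V (n - k)%N.
  by apply/eqP; rewrite -memv0 -span_nil -(take0 b) -(subnn n) iterV.
elim: k => [_|k IHk ltkn].
  by rewrite subn0 /V take_oversize ?size_tuple // (span_basis bB) memvf.
have := IHk (ltnW ltkn); rewrite -(subnSK ltkn) /=.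
apply: (V_ind _ (lact z)) => j ltjn ltj.
suff : lact z b`_j \in V j by apply/subvP/subV.
rewrite /z -applyrE linear_sum memv_suml // => p _.
by rewrite linearZ /= memvZ // Tmul.
Qed.

Theorem corollary1 (F : closedFieldType) (A M : vectType F)
    (mul : {bilinear A -> A -> A})
    (lact : {bilinear A -> M -> M}) (ract : {bilinear M -> A -> M})
    (hA : leibniz_algebra mul) (hM : leibniz_module mul lact ract) :
  (exists b : (\dim {:M}).-tuple M,
      basis_of {:M} b /\
      forall x : A,
        upper_triangular (basis_matrix b (leibniz_T lact x)) /\
        upper_triangular (basis_matrix b (leibniz_S ract x)))
  <-> nil_on lact (leibniz_square mul).
Proof.
split=> [[b [bB tri]] | nilA2].
  have [LL _ _] := hM.
  by apply: triangular_square_nil LL bB _ => x; have [] := tri x.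
pose act (s : A + A) : {linear M -> M} :=
  match s with inl x => lact x | inr x => applyr ract x end.
have [W Wact properW | b [bB tri]] := triangular_basis (f := act).
  have [|| w [wW wT wS]] := extend_submodule hM nilA2 _ _ properW.
  - by move=> x; apply: (Wact (inl x)).
  - by move=> x; apply: (Wact (inr x)).
  by exists w => // -[] x; [apply: wT | apply: wS].
by exists b; split=> // x; split; [apply: (tri (inl x)) | apply: (tri (inr x))].
Qed.
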